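(* Let $X$ be an infinite topological space satisfying at least one of the following conditions: (1) $X$ is a Hausdorff $k$-space; (2) $X$ has countable tightness and is $T_1$; (3) $X$ is weakly separated. If $\mathscr{F}[X]$ is weakly Lindelöf, then $X$ is hereditarily separable (every subspace of $X$ is separable).
   Context: Pixley-Roy hyperspace: $\mathscr{F}[X]$ is the set of all nonempty finite subsets of $X$, with the topology having as a base the sets $[F,U] := \{G : G \text{ nonempty finite subset of } X,\ F\subseteq G\subseteq U\}$, where $F$ is a nonempty finite subset of $X$ and $U$ is open in $X$. A space $Z$ is weakly Lindelöf if every open cover $\mathcal{U}$ of $Z$ has a countable subfamily $\mathcal{V}$ with $\overline{\bigcup\mathcal{V}}=Z$. A space $X$ is a $k$-space if a set $A\subseteq X$ is closed in $X$ whenever $A\cap K$ is closed in $K$ for every compact $K\subseteq X$. $X$ has countable tightness if whenever $A\subseteq X$ and $x\in\overline{A}$, there is a countable $B\subseteq A$ with $x\in\overline{B}$. A space $X$ is weakly separated if there is a family $\{U_x : x\in X\}$ of open subsets of $X$ such that $x\in U_x$ for all $x\in X$, and whenever $x,y\in X$ are distinct, $x\notin U_y$ or $y\notin U_x$. *)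

(* Defs.v *)
From HB Require Import structures.
From mathcomp Require Import all_boot all_order all_algebra finmap.
From mathcomp Require Import all_classical topology.

Set Implicit Arguments.
Unset Strict Implicit.
Unset Printing Implicit Defensive.

Local Open Scope classical_set_scope.

Definition pixley_roy (X : topologicalType) : Type :=
  {F : {fset X} | F != fset0}.

HB.instance Definition _ (X : topologicalType) :=
  Choice.copy (pixley_roy X) {F : {fset X} | F != fset0}.

Definition pr_basic (X : topologicalType) (F : pixley_roy X) (U : set X) :
    set (pixley_roy X) :=
  [set G | [set` val F] `<=` [set` val G] /\ [set` val G] `<=` U].

Definition pr_base (X : topologicalType) : set (set (pixley_roy X)) :=
  [set B | exists F U, open U /\ B = pr_basic F U].

Section PixleyRoyTopology.
Variable X : topologicalType.

Let pr_base_cover : \bigcup_(B in @pr_base X) B = [set: pixley_roy X].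
Proof.
apply/seteqP; split=> // F _; exists (pr_basic F setT); last by split.
by exists F, setT; split=> //; exact: openT.
Qed.

Let pr_base_join (A B : set (pixley_roy X)) (G : pixley_roy X) :
  pr_base A -> pr_base B -> A G -> B G ->
  exists C, [/\ pr_base C, C G & C `<=` A `&` B].
Proof.
move=> [F [U [oU ->]]] [F' [U' [oU' ->]]] [FG GU] [FG' GU'].
exists (pr_basic G (U `&` U')); split.
- by exists G, (U `&` U'); split=> //; exact: openI.
- by split=> // x Gx; split; [exact: GU | exact: GU'].
- move=> H [GH HU]; split; split.
  + exact: subset_trans GH.
  + by move=> x /HU[].
  + exact: subset_trans GH.
  + by move=> x /HU[].
Qed.

HB.instance Definition _ := isBaseTopological.Build (pixley_roy X)
  pr_base_cover pr_base_join.

End PixleyRoyTopology.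

Lemma pr_openP (X : topologicalType) (A : set (pixley_roy X)) :
  open A <-> exists2 BB, BB `<=` @pr_base X & \bigcup_(B in BB) B = A.
Proof. by []. Qed.

Definition weakly_lindelof (Z : topologicalType) :=
  forall UU : set (set Z),
    (forall U, UU U -> open U) -> \bigcup_(U in UU) U = setT ->
  exists VV : set (set Z), [/\ VV `<=` UU, countable VV &
    closure (\bigcup_(V in VV) V) = setT].

(* The types K and Y below (coerced from sets) carry the subspace topology. *)
Definition k_space (X : topologicalType) :=
  forall A : set X,
    (forall K : set X, compact K -> closed [set z : K | A (set_val z)]) ->
  closed A.

Definition countably_tight (X : topologicalType) :=
  forall (A : set X) (x : X), closure A x ->
  exists B : set X, [/\ B `<=` A, countable B & closure B x].

Definition weakly_separated (X : topologicalType) :=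
  exists U : X -> set X,
    (forall x, open (U x) /\ U x x) /\
    (forall x y, x <> y -> ~ U y x \/ ~ U x y).

Definition separable (Z : topologicalType) :=
  exists D : set Z, countable D /\ dense D.

Definition hereditarily_separable (X : topologicalType) :=
  forall Y : set X, separable Y.

(* Main.v *)
Require Import Defs.
From mathcomp Require Import all_boot all_order all_algebra finmap.
From mathcomp Require Import all_classical topology.

Local Open Scope classical_set_scope.

(** Weak Lindelofness of the hyperspace is used through neighbourhood
    assignments: given an open [U F] around every finite [F], the basic sets
    [[F, U F]] cover, so countably many finite sets [F] suffice for every basic
    open [[G, V]] to meet some [[F, U F]], that is, for [F] to lie in [V] and [G]
    in [U F] (lemma [weakly_lindelof_assignment]).

    If the sets [U x] weakly separate the points of [X], take for [U F] the
    union of the [U y] with [y] in [F].  Then every [x] is one of the countably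
    many points so obtained: for [G = {x}] and [V = U x] there are such an [F]
    inside [U x] and a [y] in [F] with [x] in [U y], which forces [x = y].
    Thus [X] is countable.

    If [A] is closed, take for [U F] the complement of [A] whenever [F] misses
    [A], and the whole space otherwise.  The sets [F] that serve a point [x] of
    [A] must then meet [A], so the countably many points found are dense in [A]:
    closed subsets of [X] are separable ([closed_countable_dense]).  With
    countable tightness this passes from the closure of a subset to the subset.

    What remains is that a Hausdorff k-space [X] is countably tight here.  In a
    T1 space a discrete subset consists of isolated points of its closure, hence
    is contained in every dense subset of that closure, hence is countable
    ([discrete_countable]).  The k-property reduces tightness to this claim: a
    subset [A] of a compact set that contains the closures of its
    countable subsets is closed ([omega_closed_compact_closed]).  If [p] were in
    the closure of [A] but not in [A], a discrete subset of [A] whose points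
    have neighbourhoods with closures avoiding [p] could always be enlarged as
    long as it is countable.  Such families satisfy a condition on pairs, which
    passes to unions of chains, so by Zorn's lemma there is a maximal one; it
    gives an uncountable discrete subset, a contradiction. *)

(** * Consequences of weak Lindelofness of the hyperspace *)

(** The conclusion is density of the union of the [[F, U F]] with [F] in [C],
    tested on the basic open sets. *)
Lemma weakly_lindelof_assignment {X : topologicalType}
    (U : pixley_roy X -> set X) :
  weakly_lindelof (pixley_roy X) ->
  (forall F, open (U F) /\ [set` val F] `<=` U F) ->
  exists2 C : set (pixley_roy X), countable C &
    forall (G : pixley_roy X) (V : set X), open V -> [set` val G] `<=` V ->
      exists F, [/\ C F, [set` val F] `<=` V & [set` val G] `<=` U F].
Proof.
move=> wL hU.
have basic_open F V : open V -> open (pr_basic F V).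
  move=> oV; apply/pr_openP; exists [set pr_basic F V]; last exact: bigcup_set1.
  by move=> _ ->; exists F, V.
have [||VV [VVU cVV dVV]] := wL (range (fun F => pr_basic F (U F))).
- by move=> _ [F _ <-]; apply: basic_open; case: (hU F).
- apply/seteqP; split=> // F _; exists (pr_basic F (U F)); first by exists F.
  by split=> //; case: (hU F).
have /choice[g hg] (B : VV) : exists F, pr_basic F (U F) = set_val B.
  by have [F _ eF] := VVU _ (set_valP B); exists F; exact: eF.
exists (range g).
  apply: (sub_countable (card_image_le _ _)).
  by rewrite (eq_countable (card_setT VV)).
move=> G V oV GV.
have [H [[B VVB BH] [GH HV]]] : (\bigcup_(B in VV) B) `&` pr_basic G V !=set0.
  have : closure (\bigcup_(B in VV) B) G by rewrite dVV.
  by apply; apply: open_nbhs_nbhs; split; [exact: basic_open | split].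
set b : VV := SigSub (mem_set VVB).
have eB : pr_basic (g b) (U (g b)) = B := hg b.
move: BH; rewrite -eB => -[FH HU]; exists (g b); split.
- by exists b.
- exact: subset_trans HV.
- exact: subset_trans HU.
Qed.

Lemma pixley_roy_set1 {X : topologicalType} (x : X) :
  exists G : pixley_roy X, [set` val G] = [set x].
Proof.
have nz : ([fset x] != fset0)%fset by apply/fset0Pn; exists x; rewrite in_fset1.
exists (exist _ [fset x]%fset nz); apply/seteqP; split=> y /=.
  by rewrite in_fset1 => /eqP.
by move=> ->; rewrite in_fset1.
Qed.

Lemma countable_points {X : topologicalType} (C : set (pixley_roy X)) :
  countable C -> countable (\bigcup_(F in C) [set` val F]).
Proof.
by move=> cC; apply: bigcup_countable => // F _; exact/finite_set_countable.
Qed.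

(** A finite set missing [A] is assigned the complement of [A], so only finite
    sets meeting [A] can serve the points of [A]. *)
Lemma closed_countable_dense {X : topologicalType} (A : set X) :
  weakly_lindelof (pixley_roy X) -> closed A ->
  exists D : set X, [/\ D `<=` A, countable D & A `<=` closure D].
Proof.
move=> wL cA.
pose U (F : pixley_roy X) : set X :=
  [set x | [set` val F] `&` A = set0 -> ~ A x].
have [F|C cC hC] := weakly_lindelof_assignment U wL.
  split=> [|x Fx FA0 Ax]; last by have : set0 x by rewrite -FA0.
  have [FA0|nFA0] := pselect ([set` val F] `&` A = set0).
    rewrite (_ : U F = ~` A); first exact: closed_openC.
    by apply/seteqP; split=> x; [move/(_ FA0) | move=> nAx].
  rewrite (_ : U F = setT); first exact: openT.
  by apply/seteqP; split=> x // _ /nFA0.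
exists (A `&` \bigcup_(F in C) [set` val F]); split.
- exact: subIsetl.
- by apply: sub_countable (countable_points _ cC); apply: subset_card_le => x [].
move=> x Ax B /nbhs_interior Bx.
have [G eG] := pixley_roy_set1 x.
have [||F [CF FB GF]] := hC G B°; first exact: open_interior.
  by rewrite eG => _ ->; exact: nbhs_singleton.
have [[y [Fy Ay]]|nFA] := pselect ([set` val F] `&` A !=set0).
  have By := @interior_subset _ B y (FB y Fy).
  by exists y; split=> //; split=> //; exists F.
have UFx : U F x by apply: GF; rewrite eG.
exfalso; apply: (UFx _ Ax).
by apply/seteqP; split=> // y FAy; case: nFA; exists y.
Qed.

Lemma weakly_separated_countable {X : topologicalType} :
  weakly_separated X -> weakly_lindelof (pixley_roy X) -> countable [set: X].
Proof.
move=> [U [hU sep]] wL.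
have [F|C cC hC] :=
    weakly_lindelof_assignment (fun F => \bigcup_(y in [set` val F]) U y) wL.
  split=> [|x Fx]; first by apply: bigcup_open => y _; case: (hU y).
  by exists x => //; case: (hU x).
apply: sub_countable (countable_points _ cC); apply: subset_card_le => x _.
have [G eG] := pixley_roy_set1 x.
have [||F [CF FU GF]] := hC G (U x); first by case: (hU x).
  by rewrite eG => _ ->; case: (hU x).
have [|y Fy Uyx] := GF x; first by rewrite eG.
have [->|/sep [|]] := pselect (x = y); first by exists F.
- by [].
- by have := FU _ Fy.
Qed.

(** An isolated point of [S] is isolated in the closure of [S], so a dense subset
    of the closure must contain it. *)
Lemma discrete_countable {X : topologicalType} (S : set X) :
  accessible_space X -> weakly_lindelof (pixley_roy X) ->
  (forall x, S x -> exists O, [/\ open O, O x & O `&` S `<=` [set x]]) ->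
  countable S.
Proof.
move=> T1 wL dS.
have [D [DS cD SD]] :=
  closed_countable_dense (closure S) wL (@closed_closure _ S).
apply: sub_countable cD; apply: subset_card_le => x Sx.
have [O [oO Ox OS]] := dS x Sx.
have [d [Dd Od]] : D `&` O !=set0.
  by apply: (SD x (subset_closure Sx)); exact: open_nbhs_nbhs.
(* A point [d] of [D] in [O] other than [x] would have the neighbourhood
   [O] minus [x], which misses [S]. *)
have [<-//|dx] := pselect (d = x).
have [|y [Sy [Oy yx]]] := DS d Dd (O `&` ~` [set x]).
  apply: open_nbhs_nbhs; split=> //; apply: openI => //.
  exact/closed_openC/accessible_closed_set1.
by case: yx; apply: OS.
Qed.

(** * From countable dense subsets to hereditary separability *)

(** Separability of the subspace type [Y], from data in the ambient space. *)
Lemma separable_set {X : topologicalType} (Y B : set X) :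
  B `<=` Y -> countable B -> Y `<=` closure B -> separable Y.
Proof.
move=> BY cB YB; exists ((set_val : Y -> X) @^-1` B); split.
  have inj : {in (set_val : Y -> X) @^-1` B &, injective (set_val : Y -> X)}.
    by move=> a b _ _; exact: val_inj.
  rewrite -(eq_countable (inj_card_eq inj)); apply: sub_countable cB.
  by apply: subset_card_le; exact: image_preimage_subset.
move=> O [y Oy] [V oV eV]; move: Oy; rewrite -eV => Vy.
have [z [Bz Vz]] := YB _ (set_valP y) V (open_nbhs_nbhs (conj oV Vy)).
by exists (SigSub (mem_set (BY z Bz))).
Qed.

Lemma countable_hereditarily_separable {X : topologicalType} :
  countable [set: X] -> hereditarily_separable X.
Proof.
move=> cX Y; apply: (separable_set Y Y) => //; last exact: subset_closure.
by apply: sub_countable cX; exact: subset_card_le.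
Qed.

Lemma countable_subset_closure_trans {X : topologicalType} (A D : set X) :
  countable D ->
  (forall d, D d ->
    exists B : set X, [/\ B `<=` A, countable B & closure B d]) ->
  exists B : set X, [/\ B `<=` A, countable B & closure D `<=` closure B].
Proof.
move=> cD hD.
have /choice[g hg] (d : D) : exists B : set X,
    [/\ B `<=` A, countable B & closure B (set_val d)].
  exact/hD/set_valP.
exists (\bigcup_(d in [set: D]) g d); split.
- by move=> x [d _ gx]; have [gA _ _] := hg d; exact: gA.
- apply: bigcup_countable => [|d _]; last by have [] := hg d.
  by rewrite (eq_countable (card_setT D)).
- move=> x clDx W /nbhs_interior Wx; have [d [Dd Wd]] := clDx _ Wx.
  have [_ _ /(_ W Wd)[y [gy Wy]]] := hg (SigSub (mem_set Dd)).
  by exists y; split=> //; exists (SigSub (mem_set Dd)).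
Qed.

(** A countable dense subset of the closure of [Y] need not lie in [Y]; tightness
    replaces each of its points by countably many points of [Y]. *)
Lemma countably_tight_hereditarily_separable {X : topologicalType} :
  countably_tight X -> weakly_lindelof (pixley_roy X) ->
  hereditarily_separable X.
Proof.
move=> tX wL Y.
have [D [DY cD YD]] :=
  closed_countable_dense (closure Y) wL (@closed_closure _ Y).
have [B [BY cB DB]] :=
  countable_subset_closure_trans Y D cD (fun d Dd => tX Y d (DY d Dd)).
apply: (separable_set Y B BY cB) => y Yy.
exact: DB (YD y (subset_closure Yy)).
Qed.

(** * Countable tightness of Hausdorff k-spaces *)

Definition omega_closed {X : topologicalType} (A : set X) :=
  forall B : set X, B `<=` A -> countable B -> closure B `<=` A.

(** Points of [A] in the successive finite intersections of the [N n] form a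
    sequence; a cluster point of it lies in [A], because [A] contains the
    closure of the range. *)
Lemma omega_closed_meets_nbhs {X : topologicalType} (K A : set X) (p : X)
    (N : nat -> set X) :
  compact K -> A `<=` K -> omega_closed A -> closure A p ->
  (forall n, nbhs p (N n)) ->
  exists2 z, A z & forall n, closure (N n) z.
Proof.
move=> cK AK oA Ap Np.
have /choice[y hy] n : exists x, A x /\ forall i, (i <= n)%N -> N i x.
  have /Ap[x [Ax Nx]] : nbhs p [set x | forall i : 'I_n.+1, N i x].
    by apply: filter_forall => i; exact: Np.
  by exists x; split=> // i le_in; exact: (Nx (Ordinal (le_in : (i < n.+1)%N))).
have [z [_ zy]] : K `&` cluster (y @ \oo) !=set0.
  apply: cK; exists 0%N => // n _; apply: AK.
  by have [] := hy n.
exists z.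
  apply: (oA (range y)).
  - by move=> _ [n _ <-]; have [] := hy n.
  - by apply: (sub_countable (card_image_le _ _)).
  - by move=> B Bz; apply: zy => //; exists 0%N => // n _; exists n.
move=> n B Bz; apply: zy => //; exists n => // m le_nm.
by have [_] := hy m; apply.
Qed.

(** Otherwise the traces on [C] of the closed neighbourhoods of [p] generate a
    proper filter.  Its cluster points in [K] lie in [C], yet equal [p] since [X] is
    Hausdorff. *)
Lemma nbhs_closure_disjoint {X : topologicalType} (K C : set X) (p : X) :
  hausdorff_space X -> compact K -> closed C -> C `<=` K -> ~ C p ->
  exists2 V, nbhs p V & closure V `&` C = set0.
Proof.
move=> hX cK cC CK nCp; apply: contrapT => noV.
pose F := filter_from (nbhs p) (fun V => closure V `&` C).
have FF : ProperFilter F.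
  apply: filter_from_proper => [|V pV]; last first.
    by apply/set0P/eqP => e; apply: noV; exists V.
  apply: filter_from_filter; first by exists setT; exact: filterT.
  move=> V W pV pW; exists (V `&` W); first exact: filterI.
  move=> x [cVW Cx]; split; split=> //; move: cVW.
    by apply: closureS; exact: subIsetl.
  by apply: closureS; exact: subIsetr.
have [|z [_ zF]] := cK F.
  by exists setT => [|x [_ /CK]//]; exact: filterT.
have Cz : C z.
  apply: cC => B Bz; apply: zF Bz.
  by exists setT => [|x []//]; exact: filterT.
apply: nCp; rewrite (hX p z) // => V W pV Wz.
have : closure (closure V) z.
  by move=> B Bz; apply: zF Bz; exists V => // x [].
by move=> /(@closed_closure _ V); apply.
Qed.

(** A maximal family of points [x] of [A] with isolating neighbourhoods [O], the
    closure of [O] avoiding a given limit point [p] outside [A], is countable as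
    its points form a discrete set.  Countability makes it extendable: some
    point of [A] lies close enough to [p] to avoid all chosen neighbourhoods
    and the closure of the set of chosen points. *)
Lemma omega_closed_compact_closed {X : topologicalType} (K A : set X) :
  hausdorff_space X -> weakly_lindelof (pixley_roy X) ->
  compact K -> A `<=` K -> omega_closed A -> closed A.
Proof.
move=> hX wL cK AK oA p clAp; apply: contrapT => nAp.
have T1 := hausdorff_accessible hX.
pose ok (q : X * set X) :=
  [/\ A q.1, open q.2, q.2 q.1 & ~ closure q.2 p].
pose good (M : set (X * set X)) :=
  M `<=` ok /\ forall q r, M q -> M r -> q <> r -> ~ q.2 r.1.
have [F Fgood Ftot|M [[Mok Mdisj] Mmax]] := @Zorn_bigcup _ good.
  split=> [q [M FM Mq]|q r [M FM Mq] [N FN Nr]].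
    by have [+ _] := Fgood M FM; apply.
  have [MN|NM] := Ftot M N FM FN.
    by have [_ +] := Fgood N FN; apply=> //; exact: MN.
  by have [_ +] := Fgood M FM; apply=> //; exact: NM.
pose S := [set q.1 | q in M].
have cS : countable S.
  apply: (discrete_countable S T1 wL) => _ [q Mq <-].
  have [_ oq qq _] := Mok q Mq.
  exists q.2; split=> // x [qx [r Mr erx]]; move: qx; rewrite -erx.
  by have [->//|/(Mdisj q r Mq Mr)] := pselect (q = r).
have cM : countable M.
  rewrite -(@eq_countable _ _ S) //; apply: inj_card_eq.
  move=> q r /set_mem Mq /set_mem Mr eqr.
  apply: contrapT => /(Mdisj q r Mq Mr); apply; rewrite -eqr.
  by have [] := Mok q Mq.
have SA : S `<=` A by move=> _ [q Mq <-]; have [] := Mok q Mq.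
have clSA := oA S SA cS.
have [||V pV VS] :=
  nbhs_closure_disjoint K (closure S) p hX cK (@closed_closure _ S).
- exact: subset_trans AK.
- by move=> /clSA.
have /countable_injP[f finj] := cM.
(* At most one pair has code [n], so [N n] is a neighbourhood of [p]. *)
pose N n := V `&` [set x | forall q, M q -> f q = n -> ~ closure q.2 x].
have Np n : nbhs p (N n).
  apply: filterI => //.
  have [[q [Mq fq]]|noq] := pselect (exists q, M q /\ f q = n); last first.
    by near=> x => q Mq fq; case: noq; exists q.
  apply: (@filterS _ _ _ (~` closure q.2)).
    move=> x nqx r Mr fr; have -> // : r = q.
    by apply: finj; rewrite ?inE // fr.
  apply: open_nbhs_nbhs; split; first exact/closed_openC/closed_closure.
  by have [] := Mok q Mq.
have [z Az Nz] := omega_closed_meets_nbhs K A p N cK AK oA clAp Np.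
have nSz : ~ closure S z.
  move=> clSz; have : set0 z; last by [].
  by rewrite -VS; split=> //; apply: closureS (Nz 0%N); exact: subIsetl.
(* [q.2] is open and disjoint from [N (f q)], hence also from its closure. *)
have nMz q : M q -> ~ q.2 z.
  move=> Mq qz; have [_ oq _ _] := Mok q Mq.
  have [x [[_ Nx] qx]] := Nz (f q) q.2 (open_nbhs_nbhs (conj oq qz)).
  by case: (Nx q Mq erefl); exact: subset_closure.
have [O [oO Oz OS Op]] :
    exists O, [/\ open O, O z, O `&` S = set0 & ~ closure O p].
  have zp : z != p by apply/eqP => zp; apply: nAp; rewrite -zp.
  move: hX; rewrite open_hausdorff => /(_ _ _ zp)[[P Q] /= [Pz Qp] [oP oQ PQ]].
  move: Pz Qp; rewrite !inE => Pz Qp.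
  exists (P `&` ~` closure S); split.
  - by apply: openI => //; exact/closed_openC/closed_closure.
  - by [].
  - by apply/seteqP; split=> // x [[_ nSx] /subset_closure].
  - move=> /(_ Q (open_nbhs_nbhs (conj oQ Qp)))[x [[Px _] Qx]].
    by have : set0 x by rewrite -(eqP PQ).
have nMzO : ~ M (z, O).
  by move=> MzO; have : set0 z by rewrite -OS; split=> //; exists (z, O).
apply: (Mmax (M `|` [set (z, O)])).
  split; first by move=> x; left.
  by move=> /(_ (z, O)) h; apply/nMzO/h; right.
split=> [q [/Mok//|->]|]; first by split.
move=> q r [Mq|->] [Mr|->] //=.
- exact: Mdisj.
- by move=> _; exact: nMz.
- by move=> _ Or; have : set0 r.1 by rewrite -OS; split=> //; exists r.
Unshelve. all: by end_near.
Qed.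

(** The points in the closures of countable subsets of [A] form a set [A'] whose
    traces on compact sets are closed, so [A'] is closed and equals the closure
    of [A]. *)
Lemma k_space_countably_tight {X : topologicalType} :
  hausdorff_space X -> k_space X -> weakly_lindelof (pixley_roy X) ->
  countably_tight X.
Proof.
move=> hX kX wL A.
pose A' := [set x | exists B : set X, [/\ B `<=` A, countable B & closure B x]].
have oA' : omega_closed A'.
  move=> B BA' cB x clBx.
  have [C [CA cC BC]] := countable_subset_closure_trans A B cB BA'.
  by exists C; split=> //; exact: BC.
have cA' : closed A'.
  apply: kX => K cK.
  have cAK : closed (A' `&` K).
    apply: (omega_closed_compact_closed K) => // B BAK cB x clBx.
    split; first by apply: oA' clBx => // y /BAK[].
    apply: (compact_closed hX cK).
    by apply: closureS clBx => y /BAK[].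
  rewrite (_ : [set z : K | A' (set_val z)] =
      (set_val : K -> X) @^-1` (A' `&` K)).
    by apply: closed_comp => // x _; exact: initial_continuous.
  apply/seteqP; split=> z /=; last by case.
  by move=> ?; split=> //; exact: set_valP.
move=> x Ax; apply: cA'; apply: closureS Ax => y Ay.
exists [set y]; split; first by move=> _ ->.
- exact: countable1.
- exact: subset_closure.
Qed.

Theorem corollary6p16 (X : topologicalType) :
  infinite_set [set: X] ->
  (hausdorff_space X /\ k_space X) \/
  (countably_tight X /\ accessible_space X) \/
  weakly_separated X ->
  weakly_lindelof (pixley_roy X) ->
  hereditarily_separable X.
Proof.
move=> _ [[hX kX]|[[tX _]|sX]] wL.
- exact/countably_tight_hereditarily_separable/wL/k_space_countably_tight.
- exact: countably_tight_hereditarily_separable.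
- exact/countable_hereditarily_separable/weakly_separated_countable.
Qed.
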